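(* Let $d\ge 1$, $q\ge 2$, $k$ and $j$ be integers with $2\le k\le q$ and $d-\frac{d-1}{q}\le j\le d$, and with $j$ even if $q=2$. Let $n=q^d$ and let $L$ be the Laplacian matrix of the graph $H(d,q,j)$. Suppose that $$\lambda=q(q-1)^{j-1}\binom{d-1}{j-1}$$ is the largest eigenvalue $\lambda_{\max}(L)$ of $L$. Then $\frac{n(k-1)}{2k}\lambda_{\max}(L)$ is equal to the optimal value of the semidefinite program $$\max\ \tfrac12\operatorname{tr}(LY)\quad\text{subject to}\quad \operatorname{diag}(Y)=u_n,\quad kY-J_n\succeq 0,\quad Y\ge 0,$$ where $Y$ ranges over real symmetric $n\times n$ matrices.
   Context: The graph $H(d,q,j)$ has as vertex set all $d$-tuples over an alphabet of size $q$ (so it has $n=q^d$ vertices), two vertices being adjacent if and only if they differ in exactly $j$ positions. It is regular of degree $\binom dj(q-1)^j$. The Laplacian matrix of a graph with adjacency matrix $A$ is $L=\operatorname{Diag}(Au_n)-A$, where $u_n$ is the all-ones vector of length $n$ and $\operatorname{Diag}(v)$ is the diagonal matrix with diagonal $v$; $\operatorname{diag}(Y)$ is the vector of diagonal entries of $Y$. $J_n$ is the $n\times n$ all-ones matrix, $M\succeq 0$ means $M$ is positive semidefinite, and $Y\ge 0$ means $Y$ is entrywise nonnegative. *)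

(* Defs.v *)
(* Mathematical Components; [R : realType] plays the role of the real numbers. *)
From HB Require Import structures.
From mathcomp Require Import all_boot all_order all_algebra.
From mathcomp Require Import sesquilinear.
From mathcomp Require Import reals.

Set Implicit Arguments.
Unset Strict Implicit.
Unset Printing Implicit Defensive.

Import Order.TTheory GRing.Theory Num.Theory.
Local Open Scope ring_scope.

(* Matrices are indexed by ['I_#|V|]; [enum_val] and [enum_rank] translate
   between the vertices and their indices. *)
Definition adjmx (R : realType) (V : finType) (e : rel V) : 'M[R]_#|V| :=
  \matrix_(x, y) (e (enum_val x) (enum_val y))%:R.

Definition ones (R : realType) (n : nat) : 'cV[R]_n := const_mx 1.

Definition Jmx (R : realType) (n : nat) : 'M[R]_n := const_mx 1.

(* [diag_mx] expects a row vector, hence the transpose. *)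
Definition laplacian (R : realType) (V : finType) (e : rel V) : 'M[R]_#|V| :=
  diag_mx (adjmx R e *m ones R #|V|)^T - adjmx R e.

Definition hdist (d q : nat) (x y : d.-tuple 'I_q) : nat :=
  #|[set i | tnth x i != tnth y i]|.

(* A simple graph only for [0 < j]; when [j = 0] every vertex has a loop. *)
Definition hamming_graph (d q j : nat) : rel (d.-tuple 'I_q) :=
  fun x y => hdist x y == j.

Definition largest_eigenvalue (R : realType) (n : nat) (A : 'M[R]_n) (a : R) :
    Prop :=
  eigenvalue A a /\ (forall b : R, eigenvalue A b -> b <= a).

Definition psdmx (R : realType) (n : nat) (A : 'M[R]_n) : Prop :=
  A \is symmetricmx /\ (forall x : 'cV[R]_n, 0 <= (x^T *m A *m x) 0 0).

Definition diagv (R : realType) (n : nat) (Y : 'M[R]_n) : 'cV[R]_n :=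
  \col_i Y i i.

Definition sdp_feasible (R : realType) (n k : nat) (Y : 'M[R]_n) : Prop :=
  [/\ Y \is symmetricmx, diagv Y = ones R n, psdmx (k%:R *: Y - Jmx R n)
    & forall i j, 0 <= Y i j].

Definition sdp_objective (R : realType) (n : nat) (L Y : 'M[R]_n) : R :=
  2^-1 * \tr (L *m Y).

(* The optimal value is a maximum: it is attained by a feasible point. *)
Definition sdp_optimal_value (R : realType) (n k : nat) (L : 'M[R]_n) (v : R) :
    Prop :=
  (exists2 Y, sdp_feasible k Y & sdp_objective L Y = v) /\
  (forall Y, sdp_feasible k Y -> sdp_objective L Y <= v).

(* Main.v *)
Require Import Defs.
From HB Require Import structures.
From mathcomp Require Import all_boot all_order all_algebra.
From mathcomp Require Import sesquilinear spectral complex ring.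
From mathcomp Require Import reals.

Set Implicit Arguments.
Unset Strict Implicit.
Unset Printing Implicit Defensive.

Import Order.TTheory GRing.Theory Num.Theory.
Local Open Scope ring_scope.

(* Upper bound: for feasible Y put Z = kY - J.  Since LJ = 0 and Z is positive
   semidefinite, k tr(LY) = tr(LZ) <= lambda_max tr(Z) = lambda_max n(k - 1).
   Attainment: Y = (J + M)/k, where M is the multiple with diagonal k - 1 of the
   projection onto the first eigenspace of the Hamming scheme; at Hamming
   distance h its entry is (k - 1)(1 - qh/(d(q - 1))), which is at least
   -(k - 1)/(q - 1) >= -1 because k <= q. *)

(** * Positive semidefinite matrices: a trace bound and a Gram form *)

Local Open Scope sesquilinear_scope.

(** [psdmx] tests real vectors only. Splitting row [i] of [P] as u + iv, the entry is the real
    number uZu^T + vZv^T plus i(vZu^T - uZv^T), and the last bracket vanishes because [Z] is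
    symmetric. *)
Lemma congr_psd_diag_ge0 (R : realType) n (Z : 'M[R]_n) (P : 'M[R[i]]_n) i :
  psdmx Z -> 0 <= (P *m map_mx (real_complex R) Z *m P ^t*) i i.
Proof.
move=> [/is_hermitianmxP]; rewrite expr0 scale1r => Zsym Zge0.
have ZT k l : Z k l = Z l k by rewrite {1}Zsym !mxE.
have quad f : 0 <= \sum_l \sum_k f k * Z k l * f l.
  have := Zge0 (\col_k f k); rewrite mxE.
  under eq_bigr do rewrite !mxE mulr_suml.
  by under eq_bigr do under eq_bigr do rewrite !mxE.
pose u k := complex.Re (P i k); pose v k := complex.Im (P i k).
have e0 : \sum_l \sum_k v k * Z k l * u l = \sum_l \sum_k u k * Z k l * v l.
  rewrite exchange_big; apply: eq_bigr => k _; apply: eq_bigr => l _ /=.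
  by rewrite ZT mulrC mulrA mulrAC.
have -> : (P *m map_mx (real_complex R) Z *m P ^t*) i i =
    real_complex R (\sum_l \sum_k u k * Z k l * u l
                    + \sum_l \sum_k v k * Z k l * v l)
    + Complex 0 1 * real_complex R (\sum_l \sum_k v k * Z k l * u l
                    - \sum_l \sum_k u k * Z k l * v l).
  rewrite mxE -!sumrB -!big_split !rmorph_sum mulr_sumr -big_split /=.
  apply: eq_bigr => l _; rewrite !mxE mulr_suml.
  rewrite -!sumrB -!big_split !rmorph_sum mulr_sumr -big_split /=.
  apply: eq_bigr => k _; rewrite !mxE /u /v.
  case: (P i k) => a b; case: (P i l) => c d.
  by apply/eqP; rewrite eq_complex /=; apply/andP; split; apply/eqP; ring.
by rewrite e0 subrr rmorph0 mulr0 addr0 ler0c addr_ge0 ?quad.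
Qed.

(* Over R[i], A = P^-1 D P with P unitary and D real diagonal, so that
   tr(AZ) is the sum of the D_i (P Z P^-1)_ii. *)
Lemma trace_mul_psd_le (R : realType) n (A Z : 'M[R]_n) a :
  A \is symmetricmx -> (forall b, eigenvalue A b -> b <= a) -> psdmx Z ->
  \tr (A *m Z) <= a * \tr Z.
Proof.
move=> Asym Aev Zpsd; pose toC := @map_mx _ _ (real_complex R) n n.
have Cherm : toC A \is hermsymmx.
  apply: realsym_hermsym.
    apply/is_hermitianmxP; move/is_hermitianmxP: Asym.
    rewrite !expr0 !scale1r => {1}->.
    by apply/matrixP => k l; rewrite !mxE.
  by apply/mxOverP => k l; rewrite mxE; apply/complex_realP; eexists.
have /orthomx_spectralP := hermitian_normalmx Cherm.
have := hermitian_spectral_diag_real Cherm.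
have := spectral_unitarymx (toC A).
move: (spectralmx _) (spectral_diag _) => P D Pu /mxOverP Dreal AE.
have Punit := unitarymx_unit Pu.
have Dle i : D 0 i <= real_complex R a.
  (* Row [i] of [P] is a left eigenvector; it is nonzero because multiplying it by [invmx P] gives a
     standard basis row. *)
  have evD : eigenvalue (toC A) (D 0 i).
    apply/eigenvalueP; exists (row i P).
      rewrite AE !mulmxA -row_mul mulmxV // row1 -rowE row_diag_mx.
      by rewrite -scalemxAl -rowE.
    apply/negP => /eqP/(congr1 (mulmx^~ (invmx P))).
    rewrite -row_mul mulmxV // mul0mx row1 => /matrixP/(_ 0 i)/eqP.
    by rewrite !mxE !eqxx oner_eq0.
  (* The eigenvalue is the image of a real [b], so it descends along the embedding to an eigenvalue
     of [A] over [R], where the bound [a] applies. *)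
  have /complex_realP[b Db] := Dreal 0 i; move: evD; rewrite Db => evb.
  by rewrite lecR Aev // -(eigenvalue_map (real_complex R)).
have trE : \tr (toC Z) = \sum_i (P *m toC Z *m P ^t*) i i.
  by rewrite -/(mxtrace _) mxtrace_mulC mulmxA -invmx_unitary // mulVmx ?mul1mx.
rewrite -lecR rmorphM -!trace_map_mx map_mxM -/(toC A) -/(toC Z) trE mulr_sumr.
rewrite AE -!mulmxA mxtrace_mulC -!mulmxA mul_diag_mx /mxtrace.
apply: ler_sum => i _; rewrite mxE invmx_unitary // mulmxA.
by apply: ler_wpM2r; [exact: congr_psd_diag_ge0 | exact: Dle].
Qed.

(** The kernel is a Gram matrix: it is [q] times the inner product of the centred indicators [w a],
    the basis vector of [g a] minus 1/q in every entry. The form is thus [q] times a sum of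
    squares. *)
Lemma coincidence_form_ge0 (R : realType) (I : finType) (q : nat)
    (g : I -> 'I_q) (f : I -> R) :
  0 <= \sum_a \sum_b f a * f b * (q%:R * (g a == g b)%:R - 1).
Proof.
(* A point of [I] has its image in ['I_q], which makes [q] positive and 1/q meaningful; for empty
   [I] the sum is 0. *)
have [a0 _|I0] := pickP (@predT I); last first.
  by rewrite big1 // => a; have := I0 a.
have q0 : q%:R != 0 :> R.
  by rewrite pnatr_eq0 -lt0n (leq_ltn_trans _ (ltn_ord (g a0))).
pose w a (c : 'I_q) : R := (g a == c)%:R - q%:R^-1.
have wE a b : \sum_c q%:R * (w a c * w b c) = q%:R * (g a == g b)%:R - 1.
  rewrite -mulr_sumr; under eq_bigr do rewrite /w mulrBl !mulrBr opprB.
  rewrite !big_split /= !sumrN sumr_const card_ord.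
  rewrite -!mulr_suml -!mulr_sumr.
  have sd (c0 : 'I_q) : \sum_c (c0 == c)%:R = 1 :> R.
    rewrite (bigD1 c0) //= eqxx big1 ?addr0 // => c /negPf.
    by rewrite eq_sym => ->.
  have -> : \sum_c (g a == c)%:R * (g b == c)%:R = (g a == g b)%:R :> R.
    rewrite (bigD1 (g a)) //= eqxx mul1r eq_sym big1 ?addr0 // => c /negPf.
    by rewrite eq_sym => ->; rewrite mul0r.
  by rewrite !sd; field.
have -> : \sum_a \sum_b f a * f b * (q%:R * (g a == g b)%:R - 1) =
    \sum_c q%:R * (\sum_a f a * w a c) ^+ 2.
  under eq_bigr => a _ do under eq_bigr => b _ do rewrite -wE mulr_sumr.
  under eq_bigr do rewrite exchange_big.
  rewrite exchange_big; apply: eq_bigr => c _.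
  rewrite expr2 mulr_suml mulr_sumr; apply: eq_bigr => a _.
  by rewrite !mulr_sumr; apply: eq_bigr => b _; ring.
by apply: sumr_ge0 => c _; rewrite mulr_ge0 ?ler0n ?sqr_ge0.
Qed.

(** * Counting in the Hamming scheme *)

Lemma hdist_sym d q (x y : d.-tuple 'I_q) : hdist x y = hdist y x.
Proof. by apply: eq_card => i; rewrite !inE eq_sym. Qed.

Lemma hdistxx d q (x : d.-tuple 'I_q) : hdist x x = 0%N.
Proof.
by apply/eqP; rewrite cards_eq0; apply/eqP/setP => i; rewrite !inE eqxx.
Qed.

Lemma hdist_le d q (x y : d.-tuple 'I_q) : (hdist x y <= d)%N.
Proof. by rewrite -[leqRHS]card_ord max_card. Qed.

(** The coordinates are chosen independently: [q - 1] values at a position of [S], a single value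
    elsewhere. Such tuples correspond to the functions in [family F]. *)
Lemma card_diff_set d q (x : d.-tuple 'I_q) (S : {set 'I_d}) :
  #|[set y : d.-tuple 'I_q | [set i | tnth x i != tnth y i] == S]| =
    ((q - 1) ^ #|S|)%N.
Proof.
pose F (i : 'I_d) : pred 'I_q :=
  if i \in S then predC1 (tnth x i) else pred1 (tnth x i).
transitivity #|family F|.
  pose t2f (y : d.-tuple 'I_q) := [ffun i => tnth y i].
  have inj : injective t2f.
    move=> y z /ffunP e; apply: eq_from_tnth => i.
    by have := e i; rewrite !ffunE.
  rewrite -(card_imset _ inj); apply: eq_card => f; apply/imsetP/familyP.
    move=> [y]; rewrite inE => /eqP/setP yS -> i; rewrite ffunE /F -yS inE.
    by case: eqP => [->|/eqP]; rewrite !inE //= eq_sym.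
  move=> fF; exists [tuple f i | i < d]; last first.
    by apply/ffunP => i; rewrite ffunE tnth_mktuple.
  rewrite inE; apply/eqP/setP => i; rewrite inE tnth_mktuple.
  have := fF i; rewrite /F; case: ifP => _; rewrite !inE eq_sym; first by [].
  by move/eqP->; rewrite eqxx.
rewrite card_family foldrE big_map big_enum /= -prod_nat_const.
rewrite [RHS]big_mkcond /=; apply: eq_bigr => i _; rewrite /F.
by case: ifP => _; rewrite ?card1 // cardC1 card_ord subn1.
Qed.

(** The sphere is partitioned by the set of positions where [y] differs from [x]. *)
Lemma card_hamming_sphere d q j (x : d.-tuple 'I_q) :
  #|[set y | hdist x y == j]| = ('C(d, j) * (q - 1) ^ j)%N.
Proof.
pose D y := [set i | tnth x i != tnth y i].
rewrite -sum1_card (partition_big D (fun S => #|S| == j)) /=; last first.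
  by move=> y; rewrite inE.
rewrite (eq_bigr (fun=> ((q - 1) ^ j)%N)); last first.
  move=> S /eqP Sj; rewrite sum1dep_card -[in RHS]Sj -(card_diff_set x S).
  apply: eq_card => y; rewrite !inE /D /hdist.
  by case: (altP (_ =P S)) => [->|]; rewrite ?andbF // Sj eqxx.
by rewrite sum_nat_const -[in RHS](card_ord d) -card_draws cardsE.
Qed.

(** * Traces against a Laplacian *)

(** The degree of [x] is itself a sum over neighbours, so each edge carries one copy of the diagonal
    entry. Degrees then need no separate evaluation. *)
Lemma trace_laplacian_mul (R : realType) (V : finType) (e : rel V)
    (Y : 'M[R]_#|V|) :
  \tr (laplacian R e *m Y) =
  \sum_x \sum_(y | e x y)
    (Y (enum_rank x) (enum_rank x) - Y (enum_rank y) (enum_rank x)).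
Proof.
rewrite (reindex (@enum_val V V)) /=; last exact/onW_bij/enum_val_bij.
apply: eq_bigr => a _.
rewrite (reindex (@enum_val V V)) /=; last exact/onW_bij/enum_val_bij.
rewrite mulmxBl mul_diag_mx !mxE mulr_suml -sumrB [RHS]big_mkcond /=.
apply: eq_bigr => b _.
rewrite !mxE !enum_valK; case: ifP => _; last by rewrite !mul0r subr0.
by rewrite mulr1 !mul1r.
Qed.

Lemma laplacian_sym (R : realType) (V : finType) (e : rel V) :
  symmetric e -> laplacian R e \is symmetricmx.
Proof.
move=> esym; apply/is_hermitianmxP; rewrite expr0 scale1r; apply/matrixP => a b.
by rewrite !mxE /= esym eq_sym; case: eqP => [->//|_]; rewrite !mulr0n.
Qed.

Lemma trace_laplacian_J (R : realType) (V : finType) (e : rel V) :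
  \tr (laplacian R e *m Jmx R #|V|) = 0.
Proof.
rewrite trace_laplacian_mul big1 // => x _; rewrite big1 // => y _.
by rewrite !mxE subrr.
Qed.

(** * The optimal point and its objective value *)

Lemma hamming_sym d q j : symmetric (@hamming_graph d q j).
Proof. by move=> x y; rewrite /hamming_graph hdist_sym. Qed.

(** The factor multiplying k - 1 is the degree-one Krawtchouk polynomial d(q - 1) - qh, normalised
    to 1 at h = 0. *)
Definition hamming_sdp_point (R : realType) (d q k : nat) :
    'M[R]_#|{: d.-tuple 'I_q}| :=
  \matrix_(a, b) (k%:R^-1 * (1 + (k%:R - 1) *
    (1 - q%:R * (hdist (enum_val a) (enum_val b))%:R / (d%:R * (q%:R - 1))))).

Lemma hamming_sdp_point_feasible (R : realType) (d q k : nat) :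
  (0 < d)%N -> (2 <= k)%N -> (k <= q)%N ->
  sdp_feasible k (hamming_sdp_point R d q k).
Proof.
move=> d0 k2 kq; have k0 : k%:R != 0 :> R by rewrite pnatr_eq0 -lt0n ltnW.
have d0' : 0 < d%:R :> R by rewrite ltr0n.
have q1' : 0 < q%:R - 1 :> R by rewrite subr_gt0 ltr1n (leq_trans k2).
have k1' : 0 <= k%:R - 1 :> R by rewrite subr_ge0 ler1n ltnW.
have q0' : 0 < q%:R :> R by rewrite ltr0n (leq_trans _ kq) // ltnW.
have qn : q%:R - 1 != 0 :> R by apply: lt0r_neq0.
have dn : d%:R != 0 :> R by apply: lt0r_neq0.
split.
- apply/is_hermitianmxP; rewrite expr0 scale1r; apply/matrixP => a b.
  by rewrite !mxE hdist_sym.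
- apply/matrixP => a b.
  by rewrite !mxE hdistxx mulr0 mul0r subr0 mulr1 subrKC mulVf.
- split.
    apply/is_hermitianmxP; rewrite expr0 scale1r; apply/matrixP => a b.
    by rewrite !mxE hdist_sym.
  move=> x.
  (* At distance h, d(q - 1) - qh is the sum over the coordinates of q[x_i = y_i] - 1, so the form
     splits into [d] coincidence forms. *)
  have -> : (x^T *m (k%:R *: hamming_sdp_point R d q k - Jmx R _) *m x) 0 0 =
    \sum_(i < d) (k%:R - 1) / (d%:R * (q%:R - 1)) *
      \sum_a \sum_b x a 0 * x b 0 *
        (q%:R * (tnth (enum_val a) i == tnth (enum_val b) i)%:R - 1).
    rewrite mxE; under eq_bigr do rewrite mxE mulr_suml.
    rewrite exchange_big -mulr_sumr [in RHS]exchange_big mulr_sumr.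
    apply: eq_bigr => a _ /=.
    rewrite [in RHS]exchange_big mulr_sumr; apply: eq_bigr => b _ /=.
    rewrite -mulr_sumr !mxE sumrB -mulr_sumr sumr_const card_ord.
    have -> : \sum_(i < d) (tnth (enum_val a) i == tnth (enum_val b) i)%:R =
      d%:R - (hdist (enum_val a) (enum_val b))%:R :> R.
      have -> : d%:R = \sum_(i < d) 1 :> R by rewrite sumr_const card_ord.
      rewrite /hdist -sum1_card natr_sum [X in _ - X]big_mkcond -sumrB.
      by apply: eq_bigr => i _; rewrite inE; case: eqP; rewrite ?subr0 ?subrr.
    by field; rewrite ?qn ?dn ?k0.
  apply: sumr_ge0 => i _; rewrite mulr_ge0 ?coincidence_form_ge0 //.
  by rewrite divr_ge0 // mulr_ge0 // ltW.
- move=> a b; rewrite mxE mulr_ge0 ?invr_ge0 ?ler0n //.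
  set h := hdist _ _; have hle : h%:R <= d%:R :> R by rewrite ler_nat hdist_le.
  (* Rewritten so that nonnegativity can be read off from h <= d and k <= q. *)
  have -> : 1 + (k%:R - 1) * (1 - q%:R * h%:R / (d%:R * (q%:R - 1))) =
    (q%:R * (k%:R - 1) * (d%:R - h%:R) + d%:R * (q%:R - k%:R)) /
    (d%:R * (q%:R - 1)) :> R.
    by field; rewrite ?qn ?dn ?k0.
  rewrite divr_ge0 ?addr_ge0 ?mulr_ge0 ?(ltW q0') ?(ltW d0') ?(ltW q1') //.
    by rewrite subr_ge0.
  by rewrite subr_ge0 ler_nat.
Qed.

Lemma trace_laplacian_hamming_sdp_point (R : realType) (d q k j : nat) :
  (0 < d)%N -> (1 < q)%N -> (0 < k)%N -> (0 < j)%N ->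
  \tr (laplacian R (@hamming_graph d q j) *m hamming_sdp_point R d q k) =
  (q ^ d)%:R * (k%:R - 1) / k%:R *
  (q%:R * (q%:R - 1) ^+ (j - 1) * ('C(d - 1, j - 1))%:R).
Proof.
move=> d0 q1 k1 j0; rewrite trace_laplacian_mul.
under eq_bigr => x _ do under eq_bigr => y /eqP xyj do
  rewrite !mxE !enum_rankK hdistxx hdist_sym xyj.
under eq_bigr => x _ do
  rewrite sumr_const -cardsE card_hamming_sphere.
rewrite sumr_const card_tuple card_ord -[LHS]mulr_natl -[X in _ * X]mulr_natl.
have dn : d%:R != 0 :> R by rewrite pnatr_eq0 -lt0n.
have qn : q%:R - 1 != 0 :> R by rewrite subr_eq0 pnatr_eq1 gtn_eqF.
(* Each of the ['C(d, j) * (q - 1) ^ j] neighbours contributes (k - 1)qj / (kd(q - 1)); this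
   absorption identity turns j/d times ['C(d, j)] into ['C(d - 1, j - 1)]. *)
have bin : d%:R * ('C(d - 1, j - 1))%:R = j%:R * ('C(d, j))%:R :> R.
  by rewrite -!natrM !subn1 mul_bin_diag prednK.
have k0 : k%:R != 0 :> R by rewrite pnatr_eq0 -lt0n.
have -> : ('C(d - 1, j - 1))%:R = j%:R * ('C(d, j))%:R / d%:R :> R.
  by rewrite -bin mulrC mulKf.
have -> : ('C(d, j) * (q - 1) ^ j)%:R =
    ('C(d, j))%:R * ((q%:R - 1) * (q%:R - 1) ^+ (j - 1)) :> R.
  by rewrite natrM natrX natrB 1?ltnW // -exprS subn1 prednK.
by field; rewrite ?qn ?dn ?k0.
Qed.

Theorem theorem9 (R : realType) (d q k j : nat)
  (hd : (1 <= d)%N) (hq : (2 <= q)%N) (hk2 : (2 <= k)%N) (hkq : (k <= q)%N)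
  (hj : d%:R - (d%:R - 1) / q%:R <= j%:R :> R) (hjd : (j <= d)%N)
  (hq2 : q = 2%N -> ~~ odd j)
  (lambda : R)
  (hlambda : lambda =
     q%:R * (q%:R - 1) ^+ (j - 1)%N * ('C(d - 1, j - 1))%:R)
  (hmax : largest_eigenvalue (laplacian R (@hamming_graph d q j)) lambda) :
  sdp_optimal_value k (laplacian R (@hamming_graph d q j))
    ((q ^ d)%:R * (k%:R - 1) / (2 * k%:R) * lambda).
Proof.
have k0 : k%:R != 0 :> R by rewrite pnatr_eq0 -lt0n ltnW.
have cardV : #|{: d.-tuple 'I_q}| = (q ^ d)%N by rewrite card_tuple card_ord.
(* Since d - 1 < dq, the lower bound on [j] is positive. Hence the truncated [j - 1] is a true
   predecessor. *)
have j_gt0 : (0 < j)%N.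
  rewrite lt0n; apply/eqP => j0; move: hj; apply/negP.
  rewrite -ltNge j0 subr_gt0 ltr_pdivrMr ?ltr0n 1?ltnW //.
  rewrite ltrBlDr (le_lt_trans (y := d%:R * q%:R)) ?ltrDl //.
  by rewrite ler_peMr ?ler0n // ler1n ltnW.
split.
  exists (hamming_sdp_point R d q k); first exact: hamming_sdp_point_feasible.
  rewrite /sdp_objective trace_laplacian_hamming_sdp_point ?(ltnW hk2) //.
  by rewrite hlambda; field.
move=> Y [_ Ydiag Ypsd _].
have symL := laplacian_sym R (@hamming_sym d q j).
have := trace_mul_psd_le symL hmax.2 Ypsd.
rewrite mulmxBr -scalemxAr !raddfB /= !linearZ /= trace_laplacian_J subr0.
have -> : \tr Y = (q ^ d)%:R.
  under [LHS]eq_bigr => i _.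
    have /matrixP/(_ i 0) := Ydiag; rewrite !mxE => ->; over.
  by rewrite sumr_const card_ord cardV.
have -> : \tr (Jmx R #|{: d.-tuple 'I_q}|) = (q ^ d)%:R.
  under [LHS]eq_bigr do rewrite mxE.
  by rewrite sumr_const card_ord cardV.
move=> le; rewrite /sdp_objective.
(* Scaling by 2k clears both the 1/2 of the objective and the denominator of the claimed value. *)
rewrite -(ler_pM2l (x := 2 * k%:R)) ?mulr_gt0 ?ltr0n ?(ltnW hk2) //.
apply: le_trans (_ : k%:R * \tr (laplacian R (@hamming_graph d q j) *m Y) <= _).
  by rewrite le_eqVlt; apply/orP; left; apply/eqP; field.
apply: le_trans le _.
by rewrite le_eqVlt; apply/orP; left; apply/eqP; field.
Qed.
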